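(* Suppose $\psi$ is an analytic function on $\mathbb{D}$ and $\varphi$ is an analytic self-map of $\mathbb{D}$ that induce a bounded weighted composition operator $W_{\psi,\varphi}$ on the Bloch space $\mathcal{B}$. Then $$\|W_{\psi,\varphi}\| \leq \max\left\{\|\psi\|_{\mathcal{B}},\ \frac{1}{2}|\psi(0)|\log\frac{1+|\varphi(0)|}{1-|\varphi(0)|} + \tau_{\psi,\varphi}^\infty + \sigma_{\psi,\varphi}^\infty\right\}.$$
   Context: $\mathbb{D}$ is the open unit disk in $\mathbb{C}$. For $f$ analytic on $\mathbb{D}$, put $\beta_f = \sup_{z\in\mathbb{D}} (1-|z|^2)|f'(z)|$. The Bloch space $\mathcal{B}$ is the complex Banach space of analytic functions $f$ on $\mathbb{D}$ with $\beta_f<\infty$, with norm $\|f\|_{\mathcal{B}} = |f(0)|+\beta_f$. The weighted composition operator is $W_{\psi,\varphi}(f) = \psi\,(f\circ\varphi)$; it is bounded on $\mathcal{B}$ if it is a bounded linear operator from $\mathcal{B}$ to $\mathcal{B}$, and $\|W_{\psi,\varphi}\|$ denotes its operator norm. Define $$\tau_{\psi,\varphi}^\infty = \sup_{z\in\mathbb{D}} \frac{1-|z|^2}{1-|\varphi(z)|^2}|\psi(z)||\varphi'(z)|,\qquad \sigma_{\psi,\varphi}^\infty = \sup_{z\in\mathbb{D}} \frac12(1-|z|^2)|\psi'(z)|\log\frac{1+|\varphi(z)|}{1-|\varphi(z)|}.$$ Both are finite when $W_{\psi,\varphi}$ is bounded on $\mathcal{B}$ (a consequence of a known result of Ohno and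 Zhao), and in that case $\psi\in\mathcal{B}$. *)

(* Defs.v *)
From Stdlib Require Import Reals.
From Coquelicot Require Import Coquelicot.

Open Scope R_scope.

(* Functions on the disk are represented by total functions [C -> C]; every
   notion below depends only on their values on the open unit disk. *)

Definition disk (z : C) : Prop := Cmod z < 1.

(* Analytic on an open set: complex differentiable at each of its points. *)
Definition analytic (f : C -> C) : Prop :=
  forall z : C, disk z -> @ex_derive C_AbsRing C_NormedModule f z.

Definition self_map (phi : C -> C) : Prop :=
  forall z : C, disk z -> disk (phi z).

(* The supremum is taken in the extended reals. *)
Definition sup_disk (g : C -> R) : Rbar :=
  Lub_Rbar (fun x : R => exists z : C, disk z /\ x = g z).

Definition bloch_beta (f : C -> C) : Rbar :=
  sup_disk (fun z => (1 - Cmod z ^ 2) * Cmod (C_derive f z)).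

Definition bloch (f : C -> C) : Prop :=
  analytic f /\ is_finite (bloch_beta f).

(* Meaningful for [f] in the Bloch space, where [bloch_beta f] is finite. *)
Definition bloch_norm (f : C -> C) : R :=
  Cmod (f (RtoC 0)) + real (bloch_beta f).

Definition bounded_operator (T : (C -> C) -> C -> C) : Prop :=
  (forall f : C -> C, bloch f -> bloch (T f)) /\
  (forall (a b : C) (f g : C -> C), bloch f -> bloch g ->
     forall z : C, disk z ->
       T (fun w => a * f w + b * g w)%C z = (a * T f z + b * T g z)%C) /\
  (exists M : R, forall f : C -> C, bloch f ->
     bloch_norm (T f) <= M * bloch_norm f).

Definition operator_norm (T : (C -> C) -> C -> C) : Rbar :=
  Lub_Rbar (fun x : R => exists f : C -> C,
    bloch f /\ bloch_norm f <= 1 /\ x = bloch_norm (T f)).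

Definition wco (psi phi : C -> C) (f : C -> C) : C -> C :=
  fun z => (psi z * f (phi z))%C.

Definition tau_infty (psi phi : C -> C) : Rbar :=
  sup_disk (fun z => (1 - Cmod z ^ 2) / (1 - Cmod (phi z) ^ 2)
                     * Cmod (psi z) * Cmod (C_derive phi z)).

Definition sigma_infty (psi phi : C -> C) : Rbar :=
  sup_disk (fun z => 1 / 2 * (1 - Cmod z ^ 2) * Cmod (C_derive psi z)
                     * ln ((1 + Cmod (phi z)) / (1 - Cmod (phi z)))).

Definition Rbar_max (x y : Rbar) : Rbar :=
  if Rbar_le_dec x y then y else x.

(* Main.v *)
Require Import Defs.
From Stdlib Require Import Reals Lra FunctionalExtensionality.
From Coquelicot Require Import Coquelicot.

(** Two pointwise bounds control a Bloch function [f]: its derivative is at most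
    [beta_f / (1 - |w|^2)], and its value is at most
    [|f 0| + beta_f * (1/2) ln ((1 + |w|) / (1 - |w|))] ([bloch_growth]), because
    the logarithm is the integral of [1 / (1 - r^2)] along the radius, that is,
    the hyperbolic distance from the origin to [w].

    Insert them, at [w = phi z], into the derivative of [psi * (f o phi)], which
    is [psi' * f (phi z) + psi * f' (phi z) * phi'], and into the value at [0].
    The contributions of [|f 0|] add up to the Bloch norm of [psi]; those of
    [beta_f] add up to the second quantity in the maximum, with the derivative
    of [psi] giving sigma and the derivative of [f] giving tau.  This
    is [bloch_norm_wco_le]: the norm of the image is at most
    [|f 0| * X + beta_f * Y], hence at most [max X Y] when [|f 0| + beta_f <= 1].

    The function [psi] is itself in the Bloch space, being the image of the
    constant [1].  If tau or sigma is infinite, the right-hand side is infinite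
    and the inequality holds trivially, so both are taken finite. *)

Open Scope R_scope.

(** * Suprema over the disk and extended real bounds *)

Lemma sup_disk_ub (g : C -> R) (z : C) : is_finite (sup_disk g) ->
  disk z -> g z <= real (sup_disk g).
Proof.
  intros Hfin Hz.
  destruct (Lub_Rbar_correct (fun x => exists z, disk z /\ x = g z)) as [Hub _].
  change (Rbar_le (g z) (real (sup_disk g))).
  rewrite Hfin.
  apply Hub; now exists z.
Qed.

Lemma sup_disk_le (g : C -> R) (M : R) :
  (forall z, disk z -> g z <= M) -> Rbar_le (sup_disk g) M.
Proof.
  intros H.
  apply (Lub_Rbar_correct (fun x => exists z, disk z /\ x = g z)).
  intros x (z & Hz & ->); now apply H.
Qed.

Lemma disk_0 : disk 0.
Proof. unfold disk; rewrite Cmod_0; lra. Qed.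

(** Ensures that a supremum over the disk is never [m_infty]. *)
Lemma sup_disk_ge_at_0 (g : C -> R) : Rbar_le (g (RtoC 0)) (sup_disk g).
Proof.
  apply (Lub_Rbar_correct (fun x => exists z, disk z /\ x = g z)).
  exists (RtoC 0); split; [exact disk_0 | reflexivity].
Qed.

Lemma one_minus_sqr_pos (r : R) : 0 <= r < 1 -> 0 < 1 - r ^ 2.
Proof. intros H; nra. Qed.

Lemma disk_weight_pos (z : C) : disk z -> 0 < 1 - Cmod z ^ 2.
Proof.
  intros Hz; apply one_minus_sqr_pos; split; [apply Cmod_ge_0 | exact Hz].
Qed.

Lemma Rbar_max_l (x y : Rbar) : Rbar_le x (Rbar_max x y).
Proof.
  unfold Rbar_max. destruct (Rbar_le_dec x y); [assumption | apply Rbar_le_refl].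
Qed.

Lemma Rbar_max_r (x y : Rbar) : Rbar_le y (Rbar_max x y).
Proof.
  unfold Rbar_max. destruct (Rbar_le_dec x y); [apply Rbar_le_refl |].
  now apply Rbar_lt_le, Rbar_not_le_lt.
Qed.

(** * Complex derivatives *)

(** [C] carries two uniform structures, the product one and the one given by the
    modulus.  Differentiability asks only for norm estimates in the codomain, so
    both give the same derivatives; the product and chain rules are stated for
    the second, [C_derive] for the first. *)
Lemma is_derive_C_iff (f : C -> C) (z l : C) :
  @is_derive C_AbsRing C_NormedModule f z l <->
  @is_derive C_AbsRing (AbsRing_NormedModule C_AbsRing) f z l.
Proof.
  split; intros [[H1 H2 H3] H];
    (split; [split; [exact H1 | exact H2 | exact H3] | exact H]).
Qed.

Lemma C_derive_wco (psi phi f : C -> C) (z : C) :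
  analytic psi -> analytic phi -> self_map phi -> analytic f -> disk z ->
  C_derive (wco psi phi f) z
  = (C_derive psi z * f (phi z)
     + psi z * (C_derive phi z * C_derive f (phi z)))%C.
Proof.
  intros Hpsi Hphi Hself Hf Hz.
  apply is_C_derive_unique.
  apply is_derive_C_iff.
  apply (@is_derive_mult C_AbsRing psi (fun w => f (phi w)) z
           (C_derive psi z) (C_derive phi z * C_derive f (phi z))%C).
  - apply is_derive_C_iff, C_derive_correct; [exact z | now apply Hpsi].
  - apply (@is_derive_comp C_AbsRing (AbsRing_NormedModule C_AbsRing) f phi).
    + apply is_derive_C_iff, C_derive_correct; [exact z | now apply Hf, Hself].
    + apply is_derive_C_iff, C_derive_correct; [exact z | now apply Hphi].
  - exact Cmult_comm.
Qed.

(** The chain rule along a ray mixes a complex derivative with a real parameter,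
    so it is obtained from the first-order expansion: the real part of
    [u * (f (s w) - f (t w) - (s - t) w l)] is bounded by [|u|] times the error
    term of [f], and the displacement is [|s - t| |w|]. *)
Lemma is_derive_Re_ray (f : C -> C) (u w l : C) (t : R) :
  @is_derive C_AbsRing C_NormedModule f (t * w)%C l ->
  is_derive (fun s : R => Re (u * f (s * w))%C) t (Re (u * l * w)%C).
Proof.
  intros [_ Hd].
  specialize (Hd (RtoC t * w)%C (fun P H => H)).
  split; [apply is_linear_scal_l |].
  intros t' Ht' eps.
  apply (@is_filter_lim_locally_unique R_AbsRing R_NormedModule) in Ht'. subst t'.
  (* the [+ 1] keeps the tolerance and the radius defined when [u] or [w] is 0 *)
  assert (HK : 0 < Cmod u * Cmod w + 1).
  { generalize (Rmult_le_pos _ _ (Cmod_ge_0 u) (Cmod_ge_0 w)); lra. }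
  assert (He : 0 < eps / (Cmod u * Cmod w + 1)).
  { apply Rdiv_lt_0_compat; [apply cond_pos | exact HK]. }
  destruct (Hd (mkposreal _ He)) as [d Hd'].
  assert (Hw : 0 < Cmod w + 1) by (generalize (Cmod_ge_0 w); lra).
  assert (Hd0 : 0 < d / (Cmod w + 1)).
  { apply Rdiv_lt_0_compat; [apply cond_pos | exact Hw]. }
  exists (mkposreal _ Hd0).
  intros s Hs.
  assert (Hst : Rabs (s - t) < d / (Cmod w + 1)) by exact Hs.
  assert (E : minus (RtoC s * w)%C (RtoC t * w)%C = (RtoC (s - t) * w)%C).
  { change (s * w - t * w = RtoC (s - t) * w)%C. rewrite RtoC_minus. ring. }
  assert (Hball : @ball (AbsRing_UniformSpace C_AbsRing) (t * w)%C d (s * w)%C).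
  { change (Cmod (minus (RtoC s * w)%C (RtoC t * w)%C) < d).
    rewrite E, Cmod_mult, Cmod_R.
    apply Rle_lt_trans with (Rabs (s - t) * (Cmod w + 1)).
    - apply Rmult_le_compat_l; [apply Rabs_pos | lra].
    - apply Rmult_lt_reg_r with (/ (Cmod w + 1)).
      + now apply Rinv_0_lt_compat.
      + rewrite Rmult_assoc, Rinv_r, Rmult_1_r by lra. exact Hst. }
  specialize (Hd' _ Hball).
  change (Cmod (minus (minus (f (s * w)%C) (f (t * w)%C))
            (Cmult (minus (RtoC s * w)%C (RtoC t * w)%C) l))
          <= eps / (Cmod u * Cmod w + 1)
             * Cmod (minus (RtoC s * w)%C (RtoC t * w)%C)) in Hd'.
  rewrite E, Cmod_mult, Cmod_R in Hd'.
  change (Rabs ((Re (u * f (s * w))%C - Re (u * f (t * w))%C)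
                - (s - t) * Re (u * l * w)%C) <= eps * Rabs (s - t)).
  set (D := minus (minus (f (s * w)%C) (f (t * w)%C)) (RtoC (s - t) * w * l)%C)
    in Hd'.
  replace (Re (u * f (s * w))%C - Re (u * f (t * w))%C
           - (s - t) * Re (u * l * w)%C) with (Re (u * D)%C).
  2:{ unfold D.
      change (Re (u * ((f (s * w) - f (t * w)) - RtoC (s - t) * w * l))%C
        = Re (u * f (s * w))%C - Re (u * f (t * w))%C
           - (s - t) * Re (u * l * w)%C).
      destruct (f (s * w)%C), (f (t * w)%C), u, l, w; simpl; ring. }
  eapply Rle_trans; [apply re_le_Cmod |].
  rewrite Cmod_mult.
  apply Rle_trans with
    (Cmod u * (eps / (Cmod u * Cmod w + 1) * (Rabs (s - t) * Cmod w))).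
  { apply Rmult_le_compat_l; [apply Cmod_ge_0 | exact Hd']. }
  apply Rle_trans with
    (eps * Rabs (s - t) * ((Cmod u * Cmod w) / (Cmod u * Cmod w + 1))).
  { right. field. lra. }
  rewrite <- (Rmult_1_r (eps * Rabs (s - t))) at 2.
  apply Rmult_le_compat_l.
  { apply Rmult_le_pos; [left; apply cond_pos | apply Rabs_pos]. }
  apply Rmult_le_reg_r with (Cmod u * Cmod w + 1); [exact HK |].
  unfold Rdiv. rewrite Rmult_assoc, Rinv_l by lra. lra.
Qed.

(** Linearizes a modulus as the real part of a fixed multiple.  The bound
    [<= 1] rather than [= 1] allows [u = 0] when [c = 0]. *)
Lemma unit_rotation (c : C) :
  exists u : C, Cmod u <= 1 /\ Re (u * c)%C = Cmod c.
Proof.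
  destruct (Ceq_dec c 0) as [-> | Hc].
  - exists 0%C. rewrite Cmod_0. split; [lra | simpl; ring].
  - assert (H : 0 < Cmod c) by now apply Cmod_gt_0.
    exists (RtoC (/ Cmod c) * Cconj c)%C. split.
    + rewrite Cmod_mult, Cmod_conj, Cmod_R, Rabs_pos_eq.
      * right. field. lra.
      * left. now apply Rinv_0_lt_compat.
    + replace (RtoC (/ Cmod c) * Cconj c * c)%C with (RtoC (Cmod c)).
      * reflexivity.
      * replace (RtoC (/ Cmod c) * Cconj c * c)%C
          with (RtoC (/ Cmod c) * (c * Cconj c))%C by ring.
        rewrite <- Cmod2_conj, <- RtoC_mult.
        f_equal. field. lra.
Qed.

(** * Growth of Bloch functions *)

(** Hyperbolic distance, for the density [1 / (1 - |z|^2)], from the origin to a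
    point of modulus [r]. *)
Definition hyp_dist (r : R) : R := 1 / 2 * ln ((1 + r) / (1 - r)).

Lemma hyp_dist_0 : hyp_dist 0 = 0.
Proof.
  unfold hyp_dist. replace ((1 + 0) / (1 - 0)) with 1 by field.
  rewrite ln_1. ring.
Qed.

Lemma is_derive_hyp_dist (r t : R) : 0 <= t * r < 1 ->
  is_derive (fun s => hyp_dist (s * r)) t (r / (1 - (t * r) ^ 2)).
Proof.
  intros H. unfold hyp_dist.
  assert (0 < (1 + t * r) / (1 - t * r)) by (apply Rdiv_lt_0_compat; lra).
  auto_derive.
  - repeat split; [lra | assumption].
  - field. assert (0 < 1 - (t * r) ^ 2) by now apply one_minus_sqr_pos.
    repeat split; lra.
Qed.

Lemma bloch_beta_ub (f : C -> C) (z : C) : bloch f -> disk z ->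
  (1 - Cmod z ^ 2) * Cmod (C_derive f z) <= real (bloch_beta f).
Proof.
  intros [_ Hfin] Hz.
  now apply (sup_disk_ub (fun w => (1 - Cmod w ^ 2) * Cmod (C_derive f w))).
Qed.

Lemma bloch_beta_ge_0 (f : C -> C) : bloch f -> 0 <= real (bloch_beta f).
Proof.
  intros Hf.
  eapply Rle_trans; [| apply (bloch_beta_ub f _ Hf disk_0)].
  apply Rmult_le_pos; [left; apply disk_weight_pos, disk_0 | apply Cmod_ge_0].
Qed.

(** Restricting [f] to the ray from [0] to [w] and rotating the difference
    [f w - f 0] onto the positive axis turns the claim into one about real
    functions on [[0, 1]]: the Bloch bound says exactly that the real part
    grows no faster than [bloch_beta f] times the hyperbolic distance from the
    origin, so the difference of the two is nondecreasing by the mean value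
    theorem. *)
Lemma bloch_growth (f : C -> C) (w : C) : bloch f -> disk w ->
  Cmod (f w - f (RtoC 0))%C <= real (bloch_beta f) * hyp_dist (Cmod w).
Proof.
  intros Hf Hw.
  destruct (unit_rotation (f w - f (RtoC 0))%C) as (u & Hu & Hre).
  set (B := real (bloch_beta f)).
  pose (h := fun t : R => B * hyp_dist (t * Cmod w) - Re (u * f (t * w))%C).
  pose (dh := fun t : R => B * (Cmod w / (1 - (t * Cmod w) ^ 2))
                 - Re (u * C_derive f (t * w) * w)%C).
  assert (Hray : forall t, 0 <= t <= 1 -> 0 <= t * Cmod w < 1).
  { intros t Ht. unfold disk in Hw. generalize (Cmod_ge_0 w). intros. nra. }
  assert (Hmod : forall t : R, 0 <= t <= 1 -> Cmod (t * w)%C = t * Cmod w).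
  { intros t Ht. rewrite Cmod_mult, Cmod_R, Rabs_pos_eq; lra. }
  assert (Hdisk : forall t : R, 0 <= t <= 1 -> disk (t * w)%C).
  { intros t Ht. unfold disk. rewrite Hmod by exact Ht. now apply Hray. }
  assert (Hder : forall t, 0 <= t <= 1 -> is_derive h t (dh t)).
  { intros t Ht. unfold h, dh.
    apply (is_derive_minus (V := R_NormedModule)
             (fun s => B * hyp_dist (s * Cmod w))).
    - apply (is_derive_scal (fun s => hyp_dist (s * Cmod w))).
      now apply is_derive_hyp_dist, Hray.
    - apply is_derive_Re_ray, C_derive_correct; [exact w |].
      now apply Hf, Hdisk. }
  assert (Hpos : forall t, 0 <= t <= 1 -> 0 <= dh t).
  { intros t Ht. unfold dh.
    assert (Hb := bloch_beta_ub f _ Hf (Hdisk t Ht)). fold B in Hb.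
    rewrite Hmod in Hb by exact Ht.
    assert (Hq := one_minus_sqr_pos _ (Hray t Ht)).
    set (q := 1 - (t * Cmod w) ^ 2) in *.
    assert (Hd : Cmod (C_derive f (t * w)%C) <= B / q).
    { apply Rmult_le_reg_l with q; [exact Hq |].
      replace (q * (B / q)) with B by (field; lra). exact Hb. }
    assert (Hre' : Re (u * C_derive f (t * w) * w)%C
                   <= Cmod u * Cmod (C_derive f (t * w)%C) * Cmod w).
    { rewrite <- !Cmod_mult. eapply Rle_trans; [apply Rle_abs |].
      apply re_le_Cmod. }
    assert (Hc : Cmod u * Cmod (C_derive f (t * w)%C) * Cmod w
                 <= 1 * (B / q) * Cmod w).
    { apply Rmult_le_compat_r; [apply Cmod_ge_0 |].
      apply Rmult_le_compat; auto using Cmod_ge_0. }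
    replace (B * (Cmod w / q)) with (1 * (B / q) * Cmod w) by (field; lra).
    lra. }
  destruct (MVT_gen h 0 1 dh) as (c & Hc & Heq);
    rewrite ?Rmin_left, ?Rmax_right in * by lra.
  - intros t Ht. apply Hder. lra.
  - intros t Ht. apply derivable_continuous_pt.
    exists (dh t). now apply is_derive_Reals, Hder.
  - assert (Hincr : h 0 <= h 1) by (specialize (Hpos c Hc); lra).
    unfold h in Hincr.
    rewrite Rmult_0_l, Rmult_1_l, hyp_dist_0, Cmult_0_l, Cmult_1_l in Hincr.
    rewrite <- Hre.
    replace (Re (u * (f w - f (RtoC 0)))%C)
      with (Re (u * f w)%C - Re (u * f (RtoC 0))%C).
    + lra.
    + destruct u, (f w), (f (RtoC 0)); simpl; ring.
Qed.

Lemma bloch_const (a : C) : bloch (fun _ => a).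
Proof.
  assert (H : forall z, @is_derive C_AbsRing C_NormedModule (fun _ => a) z zero)
    by (intros; apply is_derive_const).
  split.
  - intros z _. eexists. apply H.
  - unfold bloch_beta, is_finite.
    destruct (sup_disk _) eqn:E; [reflexivity | |]; exfalso.
    + assert (HM : Rbar_le p_infty 0); [|exact HM].
      rewrite <- E. apply sup_disk_le. intros z _.
      replace (C_derive (fun _ => a) z) with (RtoC 0)
        by (symmetry; exact (is_C_derive_unique _ _ _ (H z))).
      rewrite Cmod_0. lra.
    + assert (HM := sup_disk_ge_at_0
        (fun z => (1 - Cmod z ^ 2) * Cmod (C_derive (fun _ => a) z))).
      rewrite E in HM. exact HM.
Qed.

(** * The norm estimate *)

(** Keeping the coefficients of [|f 0|] and of [bloch_beta f] apart is what
    yields a maximum, rather than a sum, over the unit ball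
    [|f 0| + bloch_beta f <= 1]. *)
Lemma bloch_norm_wco_le (psi phi f : C -> C) :
  analytic phi -> self_map phi -> bloch psi -> bloch f ->
  bloch (wco psi phi f) ->
  is_finite (tau_infty psi phi) -> is_finite (sigma_infty psi phi) ->
  bloch_norm (wco psi phi f) <=
    Cmod (f (RtoC 0)) * bloch_norm psi +
    real (bloch_beta f) *
      (Cmod (psi (RtoC 0)) * hyp_dist (Cmod (phi (RtoC 0)))
       + real (tau_infty psi phi) + real (sigma_infty psi phi)).
Proof.
  intros Hphi Hself Hpsi Hf HW Htau Hsigma.
  set (B := real (bloch_beta f)).
  assert (Hgr : forall w, disk w ->
            Cmod (f w) <= Cmod (f (RtoC 0)) + B * hyp_dist (Cmod w)).
  { intros w Hw.
    replace (f w) with (f (RtoC 0) + (f w - f (RtoC 0)))%C by ring.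
    eapply Rle_trans; [apply Cmod_triangle |].
    apply Rplus_le_compat_l. now apply bloch_growth. }
  assert (Hbeta : real (bloch_beta (wco psi phi f)) <=
            Cmod (f (RtoC 0)) * real (bloch_beta psi)
            + B * (real (tau_infty psi phi) + real (sigma_infty psi phi))).
  { change (Rbar_le (real (bloch_beta (wco psi phi f)))
      (Cmod (f (RtoC 0)) * real (bloch_beta psi)
            + B * (real (tau_infty psi phi) + real (sigma_infty psi phi)))).
    rewrite (proj2 HW).
    apply sup_disk_le. intros z Hz.
    rewrite C_derive_wco by (trivial; now apply Hpsi || apply Hf).
    assert (Hp := Hself z Hz).
    assert (Hq := disk_weight_pos z Hz).
    assert (Hqp := disk_weight_pos _ Hp).
    assert (Hb := bloch_beta_ub psi z Hpsi Hz).
    assert (Hfb := bloch_beta_ub f _ Hf Hp). fold B in Hfb.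
    assert (Ht := sup_disk_ub (fun z => (1 - Cmod z ^ 2) / (1 - Cmod (phi z) ^ 2)
                     * Cmod (psi z) * Cmod (C_derive phi z)) z Htau Hz).
    assert (Hs := sup_disk_ub (fun z => 1 / 2 * (1 - Cmod z ^ 2) * Cmod (C_derive psi z)
                     * ln ((1 + Cmod (phi z)) / (1 - Cmod (phi z)))) z Hsigma Hz).
    cbv beta in Ht, Hs. fold (tau_infty psi phi) in Ht.
    fold (sigma_infty psi phi) in Hs.
    assert (HB : 0 <= B) by now apply bloch_beta_ge_0.
    set (q := 1 - Cmod z ^ 2) in *. set (p := 1 - Cmod (phi z) ^ 2) in *.
    apply Rle_trans with
      (q * (Cmod (C_derive psi z) * (Cmod (f (RtoC 0)) + B * hyp_dist (Cmod (phi z)))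
       + Cmod (psi z) * (Cmod (C_derive phi z) * (B / p)))).
    - apply Rmult_le_compat_l; [lra |].
      eapply Rle_trans; [apply Cmod_triangle |].
      rewrite !Cmod_mult.
      apply Rplus_le_compat.
      + apply Rmult_le_compat_l; [apply Cmod_ge_0 | now apply Hgr].
      + apply Rmult_le_compat_l; [apply Cmod_ge_0 |].
        apply Rmult_le_compat_l; [apply Cmod_ge_0 |].
        apply Rmult_le_reg_l with p; [exact Hqp |].
        replace (p * (B / p)) with B by (field; lra). exact Hfb.
    - apply Rle_trans with
        (Cmod (f (RtoC 0)) * (q * Cmod (C_derive psi z))
         + B * (q / p * Cmod (psi z) * Cmod (C_derive phi z)
          + 1 / 2 * q * Cmod (C_derive psi z)
             * ln ((1 + Cmod (phi z)) / (1 - Cmod (phi z))))).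
      + right. unfold hyp_dist. field. lra.
      + apply Rplus_le_compat; apply Rmult_le_compat_l;
          [apply Cmod_ge_0 | exact Hb | exact HB | lra]. }
  unfold bloch_norm at 1.
  assert (H0 : Cmod (wco psi phi f (RtoC 0)) <=
     Cmod (psi (RtoC 0)) *
     (Cmod (f (RtoC 0)) + B * hyp_dist (Cmod (phi (RtoC 0))))).
  { unfold wco. rewrite Cmod_mult.
    apply Rmult_le_compat_l; [apply Cmod_ge_0 |].
    apply Hgr, Hself, disk_0. }
  unfold bloch_norm. lra.
Qed.

Theorem theorem2p2 (psi phi : C -> C)
    (hpsi : analytic psi) (hphi : analytic phi) (hself : self_map phi)
    (hW : bounded_operator (wco psi phi)) :
  Rbar_le (operator_norm (wco psi phi))
    (Rbar_max (Finite (bloch_norm psi))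
       (Rbar_plus
          (Rbar_plus
             (Finite (1 / 2 * Cmod (psi (RtoC 0))
                * ln ((1 + Cmod (phi (RtoC 0))) / (1 - Cmod (phi (RtoC 0))))))
             (tau_infty psi phi))
          (sigma_infty psi phi))).
Proof.
  assert (Hpsi : bloch psi).
  { assert (E : wco psi phi (fun _ => RtoC 1) = psi).
    { apply functional_extensionality. intros z. unfold wco. ring. }
    rewrite <- E. apply hW, bloch_const. }
  unfold operator_norm.
  apply Lub_Rbar_correct.
  intros x (f & Hf & Hnorm & ->).
  assert (Hwf := proj1 hW f Hf).
  assert (Hle := bloch_norm_wco_le psi phi f hphi hself Hpsi Hf Hwf).
  match goal with
  | |- Rbar_le _ (Rbar_max ?x ?y) =>
      assert (HA := Rbar_max_l x y); assert (HB := Rbar_max_r x y)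
  end.
  assert (Hf0 := bloch_beta_ge_0 f Hf).
  assert (Htau := sup_disk_ge_at_0 (fun z => (1 - Cmod z ^ 2) / (1 - Cmod (phi z) ^ 2)
                     * Cmod (psi z) * Cmod (C_derive phi z))).
  assert (Hsig := sup_disk_ge_at_0 (fun z => 1 / 2 * (1 - Cmod z ^ 2) * Cmod (C_derive psi z)
                     * ln ((1 + Cmod (phi z)) / (1 - Cmod (phi z))))).
  fold (tau_infty psi phi) in Htau. fold (sigma_infty psi phi) in Hsig.
  destruct (tau_infty psi phi) as [tau | |]; [| | contradiction];
    (destruct (sigma_infty psi phi) as [sigma | |]; [| | contradiction]);
    cbn [Rbar_plus Rbar_plus'] in HA, HB |- *.
  (* tau or sigma infinite: the right-hand side is [p_infty] *)
  2,3,4: destruct (Rbar_max _ _); [contradiction | exact I | contradiction].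
  specialize (Hle eq_refl eq_refl).
  destruct (Rbar_max _ _) as [M | |]; [| exact I | contradiction].
  simpl in HA, HB |- *.
  set (D := _ + tau + sigma) in HB.
  replace (_ + real tau + real sigma) with D in Hle
    by (unfold D, hyp_dist; simpl; field).
  unfold bloch_norm at 1 in Hnorm.
  assert (HM : 0 <= bloch_norm psi).
  { apply Rplus_le_le_0_compat; [apply Cmod_ge_0 | now apply bloch_beta_ge_0]. }
  assert (Hf1 := Cmod_ge_0 (f (RtoC 0))).
  nra.
Qed.
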